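(* Let $m,n$ be positive integers with $n\ge 2$. There always exists a set of $n+4$ non-degenerate equimultiple fat points $Z=mP_1+\cdots+mP_{n+4}$ in $\mathbb P^n$ (with $P_1,\dots,P_{n+4}$ distinct) such that $$\operatorname{reg}(Z)=3m-1<T(Z)=3m,$$ where $$T(Z)=\max\{T_j(Z)\mid j=1,\dots,n\},$$ $$T_j(Z)=\max\left\{\left[\frac{mq+j-2}{j}\right]\ \Big|\ P_{i_1},\dots,P_{i_q}\text{ lie on a }j\text{-dimensional linear subspace}\right\}.$$
   Context: $K$ is an algebraically closed field of arbitrary characteristic and $\mathbb P^n=\mathbb P^n_K$, with homogeneous coordinate ring $R=K[X_0,\dots,X_n]$. For distinct points $P_1,\dots,P_s\in\mathbb P^n$ with homogeneous prime ideals $\wp_1,\dots,\wp_s\subset R$ and a positive integer $m$, the set of equimultiple fat points $Z=mP_1+\cdots+mP_s$ is the zero-dimensional scheme defined by $I=\wp_1^{m}\cap\cdots\cap\wp_s^{m}$. It is non-degenerate in $\mathbb P^n$ if $P_1,\dots,P_s$ span $\mathbb P^n$. The regularity index $\operatorname{reg}(Z)$ is the least integer $t$ such that $\dim_K(R/I)_t=s\binom{m+n-1}{n}$. $[a]$ denotes the integer part of a rational number $a$. In the definition of $T_j(Z)$ the maximum is over all subsets $\{P_{i_1},\dots,P_{i_q}\}$ of $q$ distinct points among the given points that are contained in some $j$-dimensional linear subspace of $\mathbb P^n$. *)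

(* Defs.v *)
(* Mathematical Components, with multinomials for K[X_0, ..., X_n]; boolp is
   used only to turn a Prop into the boolean filter of a finite maximum. *)
From mathcomp Require Import all_boot all_order all_algebra.
From mathcomp Require Import mpoly.
From mathcomp Require Import boolp.

Set Implicit Arguments.
Unset Strict Implicit.
Unset Printing Implicit Defensive.

Import GRing.Theory.
Local Open Scope ring_scope.

Section Ideals.

Variable A : comNzRingType.
Implicit Types (S I : A -> Prop) (f : A).

Definition ideal_gen S f : Prop :=
  exists (k : nat) (h g : 'I_k -> A),
    (forall i, S (g i)) /\ f = \sum_(i < k) h i * g i.

Definition ideal_pow I (m : nat) : A -> Prop :=
  ideal_gen (fun f => exists a : 'I_m -> A,
    (forall i, I (a i)) /\ f = \prod_(i < m) a i).

End Ideals.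

Section ProjectiveSpace.

Variables (K : closedFieldType) (n : nat).

(* P^n is the set of lines through the origin of K^(n+1), so that Leibniz
   equality is equality of projective points. Accordingly, a j-dimensional
   linear subspace of P^n is a (j+1)-dimensional vector subspace W, and it
   contains the point P when P <= W. *)
Definition proj_point := {L : {vspace 'rV[K]_n.+1} | \dim L == 1%N}.

Definition vanishes_at (f : {mpoly K[n.+1]}) (P : proj_point) : Prop :=
  forall v, v \in val P -> f.@[v 0] = 0.

Definition point_ideal (P : proj_point) : {mpoly K[n.+1]} -> Prop :=
  ideal_gen (fun f => (exists d : nat, f \is d.-homog) /\ vanishes_at f P).

(* For a homogeneous ideal I: dim_K (R/I)_t = d, i.e. there are d forms of
   degree t whose classes modulo I are a basis of R_t / I_t. *)
Definition graded_quot_dim (I : {mpoly K[n.+1]} -> Prop) (t d : nat) : Prop :=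
  exists e : 'I_d -> {mpoly K[n.+1]},
    [/\ forall i, e i \is t.-homog,
        forall c : 'I_d -> K,
          I (\sum_(i < d) c i *: e i) -> forall i, c i = 0
      & forall f, f \is t.-homog ->
          exists c : 'I_d -> K, I (f - \sum_(i < d) c i *: e i)].

Section FatPoints.

Variables (s m : nat) (P : 'I_s -> proj_point).

Definition non_degenerate : Prop := (\sum_(i < s) val (P i))%VS = fullv.

Definition fat_points_ideal (f : {mpoly K[n.+1]}) : Prop :=
  forall i, ideal_pow (point_ideal (P i)) m f.

Definition has_expected_dim (t : nat) : Prop :=
  graded_quot_dim fat_points_ideal t (s * 'C(m + n - 1, n)).

(* Degrees t < 0 need not be considered: there (R/I)_t = 0, whereas the
   expected dimension is positive as soon as s > 0 and m > 0. *)
Definition is_regularity_index (r : nat) : Prop :=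
  has_expected_dim r /\ forall t : nat, has_expected_dim t -> (r <= t)%N.

Definition on_linear_subspace (j : nat) (B : {set 'I_s}) : Prop :=
  exists W : {vspace 'rV[K]_n.+1},
    \dim W = j.+1 /\ forall i, i \in B -> (val (P i) <= W)%VS.

(* B = set0 contributes nothing: its (truncated) value never exceeds the one
   of a singleton when 1 <= j <= n and m > 0. *)
Definition Tj (j : nat) : nat :=
  \max_(B : {set 'I_s} | `[< on_linear_subspace j B >])
    ((m * #|B| + j - 2) %/ j)%N.

Definition Tmax : nat := \max_(1 <= j < n.+1) Tj j.

End FatPoints.

End ProjectiveSpace.

(* Main.v *)
(* The points are e_0, ..., e_n together with e_1 + e_2, e_0 + e_2, e_0 + e_1.
   Each P_i has a quadric Q_i, a product of two linear forms, that passes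
   through all the other points but not through P_i. The products of Q_i^m
   with the monomials of degree m - 1 then form a basis of (R/I)_(3m-1): they
   generate because a form of degree at least m is, modulo the m-th power of the
   ideal of a point, divisible by any given linear form nonzero at that point,
   and they are independent because no nonzero form of degree m - 1 has
   multiplicity m at a point.
   Conversely, an expected dimension in degree t makes all jets of order m - 1
   realisable in that degree. Hence some form of degree t, restricted to the
   line through e_0, e_1 and e_0 + e_1, has order exactly m - 1 at one of these
   points and at least m at the other two, whence t >= 3m - 1.
   Finally a j-dimensional linear subspace contains at most 3j of the points, and
   six of them lie on a plane, whence T(Z) = 3m. *)
Require Import Defs.
From HB Require Import structures.
From mathcomp Require Import all_boot all_order all_algebra.
From mathcomp Require Import mpoly boolp ring zify.

Set Implicit Arguments.
Unset Strict Implicit.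
Unset Printing Implicit Defensive.

Import GRing.Theory.

(** * Closure properties of generated ideals and their powers *)

Section IdealClosure.

Local Open Scope ring_scope.

Variable A : comNzRingType.
Implicit Types (S I : A -> Prop) (f g : A).

Lemma ideal_gen_mem S f : S f -> ideal_gen S f.
Proof.
by move=> Sf; exists 1, (fun=> 1), (fun=> f); rewrite big_ord1 mul1r.
Qed.

Lemma ideal_gen0 S : ideal_gen S 0.
Proof. by exists 0, (fun=> 0), (fun=> 0); split=> [[]//|]; rewrite big_ord0. Qed.

Lemma ideal_genD S f g : ideal_gen S f -> ideal_gen S g -> ideal_gen S (f + g).
Proof.
move=> [k [h [u [Su ->]]]] [l [h' [u' [Su' ->]]]].
pose cat (x : 'I_k -> A) (y : 'I_l -> A) i :=
  match split i with inl a => x a | inr b => y b end.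
exists (k + l)%N, (cat h h'), (cat u u'); split=> [i|].
  by rewrite /cat; case: (split i).
rewrite big_split_ord /=; congr (_ + _); apply: eq_bigr => i _.
  by rewrite /cat -[lshift l i]/(unsplit (inl i)) unsplitK.
by rewrite /cat -[rshift k i]/(unsplit (inr i)) unsplitK.
Qed.

Lemma ideal_genM S f g : ideal_gen S g -> ideal_gen S (f * g).
Proof.
move=> [k [h [u [Su ->]]]]; exists k, (fun i => f * h i), u; split=> //.
by rewrite mulr_sumr; apply: eq_bigr => i _; rewrite mulrA.
Qed.

Lemma ideal_gen_sum S (J : Type) (r : seq J) (P : pred J) (F : J -> A) :
  (forall j, P j -> ideal_gen S (F j)) -> ideal_gen S (\sum_(j <- r | P j) F j).
Proof.
move=> SF; elim/big_ind: _ => //; [exact: ideal_gen0 | exact: ideal_genD].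
Qed.

Lemma ideal_genN S f : ideal_gen S f -> ideal_gen S (- f).
Proof. by rewrite -mulN1r; apply: ideal_genM. Qed.

Lemma ideal_genB S f g : ideal_gen S f -> ideal_gen S g -> ideal_gen S (f - g).
Proof. by move=> Sf Sg; apply/ideal_genD/ideal_genN. Qed.

Lemma ideal_powX I m f : I f -> ideal_pow I m (f ^+ m).
Proof.
move=> If; apply: ideal_gen_mem; exists (fun=> f); split=> //.
by rewrite prodr_const card_ord.
Qed.

Lemma ideal_pow1 I f : I f -> ideal_pow I 1 f.
Proof. by move/(ideal_powX 1); rewrite expr1. Qed.

Lemma ideal_powS I m f g : I f -> ideal_pow I m g -> ideal_pow I m.+1 (f * g).
Proof.
move=> If [k [h [u [Iu ->]]]]; rewrite mulr_sumr; apply: ideal_gen_sum => i _.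
rewrite mulrCA; apply/ideal_genM/ideal_gen_mem.
have [a [Ia ->]] := Iu i.
exists (fun j => if unlift ord0 j is Some j' then a j' else f); split=> [j|].
  by case: (unlift _ _).
rewrite big_ord_recl unlift_none; congr (_ * _).
by apply: eq_bigr => j _; rewrite liftK.
Qed.

End IdealClosure.

(** * Splitting variables off forms *)

Section Forms.

Local Open Scope ring_scope.

Variables (R : comNzRingType) (n : nat).
Implicit Types (f g : {mpoly R[n]}) (d : nat).

Lemma dhomogXU (i : 'I_n) : ('X_i : {mpoly R[n]}) \is 1.-homog.
Proof. by rewrite dhomogX /= mdeg1. Qed.

(** Every monomial of positive degree is divisible by some variable; the variables are split off one
    monomial at a time. The inductions on the degree below rest on this. *)
Lemma dhomogS_decomp d f : f \is d.+1.-homog ->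
  exists2 h : 'I_n -> {mpoly R[n]},
    forall i, h i \is d.-homog & f = \sum_i 'X_i * h i.
Proof.
move=> /dhomogP hf.
suff [h hh Eh] : exists2 h : 'I_n -> {mpoly R[n]}, forall i, h i \is d.-homog &
    \sum_(m <- msupp f) f@_m *: 'X_[m] = \sum_i 'X_i * h i.
  by exists h => //; rewrite -Eh; apply: mpolyE.
elim: (msupp f) hf => [|m s IHs] hf.
  exists (fun=> 0) => [i|]; first exact: dhomog0.
  by rewrite big_nil big1 // => i _; rewrite mulr0.
have [|h hh Eh] := IHs; first by move=> m' ms; apply: hf; rewrite inE ms orbT.
have dm : mdeg m = d.+1 by apply: hf; rewrite mem_head.
have [i mi] : exists i, m i != 0%N.
  apply/existsP; rewrite -negb_forall; apply/negP => /forallP m0.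
  by move: dm; rewrite mdegE big1 // => i _; apply/eqP/m0.
have Em : m = (U_(i) + (m - U_(i)))%MM by rewrite addmC submK // lep1mP.
exists (fun j => h j + (i == j)%:R *: (f@_m *: 'X_[m - U_(i)])) => [j|].
  rewrite dhomogD ?hh // dhomogZ // dhomogZ // dhomogX /= -eqSS -dm {2}Em mdegD.
  by rewrite mdeg1.
rewrite big_cons Eh addrC; under [RHS]eq_bigr => j _ do rewrite mulrDr.
rewrite big_split /=; congr (_ + _).
rewrite (bigD1 i) //= eqxx scale1r big1 ?addr0 => [|j /negPf nij].
  by rewrite -scalerAr -mpolyXD -Em.
by rewrite eq_sym nij scale0r mulr0.
Qed.

End Forms.

(** * Division by linear forms modulo powers of the ideal of one point *)

Section LocalReduction.

Local Open Scope ring_scope.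

Variables (K : closedFieldType) (n : nat).
Implicit Types (f g h : {mpoly K[n.+1]}) (v : 'rV[K]_n.+1) (P : proj_point K n).

Lemma point_ideal_mem P d f :
  f \is d.-homog -> vanishes_at f P -> point_ideal P f.
Proof. by move=> hf Pf; apply: ideal_gen_mem; split=> //; exists d. Qed.

Lemma dhomog1_vanishes P v f :
  val P = <[v]>%VS -> f \is 1.-homog -> f.@[v 0] = 0 -> vanishes_at f P.
Proof.
move=> Pv /dhomogS_decomp[h hh ->] fv w.
rewrite Pv => /vlineP[c ->]; rewrite -[RHS](mulr0 c) -fv.
rewrite !raddf_sum /= mulr_sumr; apply: eq_bigr => i _.
rewrite !mevalM !mevalXU !mxE mulrA; congr (_ * _).
have [a ->] : exists a, h i = a%:MP.
  exists (h i)@_0; apply: msize1_polyC; rewrite msizeE.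
  by apply/bigmax_leqP_seq => m mh _; rewrite (dhomogP _ _ _ (hh i) m mh).
by rewrite !mevalC.
Qed.

Lemma point_ideal_linear P v f :
  val P = <[v]>%VS -> f \is 1.-homog -> f.@[v 0] = 0 -> point_ideal P f.
Proof.
by move=> Pv hf fv; apply: point_ideal_mem (hf) _; apply: dhomog1_vanishes Pv hf fv.
Qed.

Variables (P : proj_point K n) (v : 'rV[K]_n.+1).
Hypothesis Pv : val P = <[v]>%VS.

(** Modulo the ideal of [P] each variable ['X_i] is the multiple [c i] of [h], with [c i] the ratio
    of their values at [v]. Induction on [m] lifts this congruence to the powers of the ideal. *)
Lemma reduce_linear_low h m f :
    h \is 1.-homog -> h.@[v 0] != 0 -> f \is m.+1.-homog ->
  exists2 g, g \is m.-homog & ideal_pow (point_ideal P) m.+1 (f - h * g).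
Proof.
move=> hh hv.
pose c i : K := v 0 i / h.@[v 0].
have cI i : point_ideal P ('X_i - c i *: h).
  apply: point_ideal_linear Pv _ _.
    by rewrite rpredB ?dhomogXU // dhomogZ.
  by rewrite mevalB mevalXU mevalZ divfK ?subrr.
elim: m f => [|m IHm] f /dhomogS_decomp[u hu ->].
  exists (\sum_i c i *: u i); first by rewrite rpred_sum // => i _; rewrite dhomogZ.
  rewrite mulr_sumr -sumrB; apply: ideal_gen_sum => i _.
  rewrite -scalerAr scalerAl -mulrBl mulrC.
  by apply/ideal_genM/ideal_pow1/cI.
have [w hw Ew] : exists2 w : 'I_n.+1 -> {mpoly K[n.+1]},
    forall i, w i \is m.-homog &
    forall i, ideal_pow (point_ideal P) m.+1 (u i - h * w i).
  have /fin_all_exists[w hw] : forall i, exists w,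
      w \is m.-homog /\ ideal_pow (point_ideal P) m.+1 (u i - h * w).
    by move=> i; have [w ? ?] := IHm _ (hu i); exists w.
  by exists w => i; case: (hw i).
exists (\sum_i (c i *: u i + ('X_i - c i *: h) * w i)).
  rewrite rpred_sum // => i _; rewrite dhomogD ?dhomogZ //.
  by apply: (dhomogM (d := 1)) (hw i); rewrite rpredB ?dhomogXU // dhomogZ.
rewrite mulr_sumr -sumrB; apply: ideal_gen_sum => i _.
(* The correction term in the witness makes the error factor: one factor lies in the ideal of [P],
   the other in its power [m.+1] by induction. *)
suff -> : 'X_i * u i - h * (c i *: u i + ('X_i - c i *: h) * w i) =
    ('X_i - c i *: h) * (u i - h * w i) by apply: ideal_powS.
rewrite -!mul_mpolyC; ring.
Qed.

Lemma reduce_linear h m d f :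
    h \is 1.-homog -> h.@[v 0] != 0 -> f \is (m.+1 + d).-homog ->
  exists2 g, g \is (m + d).-homog & ideal_pow (point_ideal P) m.+1 (f - h * g).
Proof.
move=> hh hv; elim: d f => [|d IHd] f.
  by rewrite !addn0; apply: reduce_linear_low.
rewrite !addnS => /dhomogS_decomp[u hu ->].
have /fin_all_exists[w hw] : forall i, exists w,
    w \is (m + d).-homog /\ ideal_pow (point_ideal P) m.+1 (u i - h * w).
  by move=> i; have [w ? ?] := IHd _ (hu i); exists w.
exists (\sum_i 'X_i * w i).
  rewrite rpred_sum // => i _; have [hwi _] := hw i.
  exact: (dhomogM (d := 1)) (dhomogXU _ _) hwi.
rewrite mulr_sumr -sumrB; apply: ideal_gen_sum => i _.
by rewrite mulrCA -mulrBr; apply: ideal_genM; case: (hw i).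
Qed.

(** The linear forms are split off one by one, each lowering the degree by one, until degree [m] is
    reached. *)
Lemma reduce_linear_prod (hs : seq {mpoly K[n.+1]}) m f :
    {in hs, forall h, h \is 1.-homog /\ h.@[v 0] != 0} ->
    f \is (m + size hs).-homog ->
  exists2 g, g \is m.-homog &
    ideal_pow (point_ideal P) m.+1 (f - (\prod_(h <- hs) h) * g).
Proof.
elim: hs f => [|h hs IHhs] f hP hf.
  exists f; first by rewrite addn0 in hf.
  by rewrite big_nil mul1r subrr; apply: ideal_gen0.
have [hh hv] := hP h (mem_head _ _).
rewrite addnS -addSn in hf; have [f' hf' If'] := reduce_linear hh hv hf.
have [|g hg Ig] := IHhs f' _ hf'.
  by move=> h' hs'; apply: hP; rewrite inE hs' orbT.
exists g => //; rewrite big_cons -mulrA -(subrKA (h * f')) -mulrBr.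
by apply/ideal_genD/ideal_genM.
Qed.

End LocalReduction.

(** * Restriction of forms to a parametrised line *)

Section LineRestriction.

Local Open Scope ring_scope.

Variables (K : closedFieldType) (n : nat) (F : fieldType) (iota : {rmorphism K -> F}).
Variables (a w : 'I_n.+1 -> F).
Implicit Types (f : {mpoly K[n.+1]}) (P : proj_point K n) (t : F).

(** The line is [a] + t [w]. Coefficients pass through [iota] into [F], so that the same map serves
    lines over [K] and the generic line over a function field. *)
Definition restrict_line : {mpoly K[n.+1]} -> {poly F} :=
  mmap (polyC \o iota) (fun i => (a i)%:P + w i *: 'X).

HB.instance Definition _ := GRing.RMorphism.on restrict_line.

Lemma restrict_line_horner f t :
  (restrict_line f).[t] = mmap iota (fun i => a i + t * w i) f.
Proof.
rewrite /restrict_line /mmap horner_sum; apply: eq_bigr => m _.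
rewrite hornerM hornerC /mmap1 horner_prod; congr (_ * _).
by apply: eq_bigr => i _; rewrite horner_exp !hornerE mulrC.
Qed.

Lemma size_restrict_line d f : f \is d.-homog -> (size (restrict_line f) <= d.+1)%N.
Proof.
move=> /dhomogP hf; rewrite /restrict_line /mmap; apply: (leq_trans (size_sum _ _ _)).
apply/bigmax_leqP_seq => m /hf <- _; rewrite /= mul_polyC.
apply: (leq_trans (size_scale_leq _ _)).
rewrite /mmap1 mdegE; elim/big_rec2: _ => [|i k q _ IH]; first by rewrite size_poly1.
apply: (leq_trans (size_polyMleq _ _)); rewrite -subn1 leq_subLR add1n.
suff S : (size (((a i)%:P + w i *: 'X) ^+ m i) <= (m i).+1)%N.
  by apply: leq_trans (leq_add S IH) _; rewrite addnS addSn.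
apply: (leq_trans (size_poly_exp_leq _ _)); rewrite ltnS -[leqRHS]mul1n leq_mul //.
rewrite -subn1 leq_subLR (leq_trans (size_polyD _ _)) // geq_max.
rewrite size_polyC (leq_trans (leq_b1 _)) //=.
by rewrite (leq_trans (size_scale_leq _ _)) // size_polyX.
Qed.

(** By homogeneity f(c v) = c^d f(v), so the line need only meet a multiple of the representative
    [v]. *)
Lemma restrict_line_root P v c t f d :
    val P = <[v]>%VS -> (forall i, a i + t * w i = c * iota (v 0 i)) ->
  f \is d.-homog -> vanishes_at f P -> root (restrict_line f) t.
Proof.
move=> Pv Et /dhomogP hf /(_ v); rewrite Pv memv_line => /(_ isT) fv.
rewrite /root restrict_line_horner.
suff -> : mmap iota (fun i => a i + t * w i) f = c ^+ d * iota f.@[v 0].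
  by rewrite fv // rmorph0 mulr0.
rewrite mevalE rmorph_sum mulr_sumr /mmap big_seq [RHS]big_seq.
apply: eq_bigr => m /hf /= <-; rewrite rmorphM rmorph_prod mulrCA; congr (_ * _).
rewrite mdegE expr_sum -big_split; apply: eq_bigr => i _.
by rewrite Et rmorphXn exprMn.
Qed.

(** Generators of the ideal of [P] restrict to polynomials with root [t], so an [m]-fold product
    picks up [m] factors 'X - t. *)
Lemma restrict_line_dvdp P v c t f m :
    val P = <[v]>%VS -> (forall i, a i + t * w i = c * iota (v 0 i)) ->
  ideal_pow (point_ideal P) m f -> ('X - t%:P) ^+ m %| restrict_line f.
Proof.
move=> Pv Et [k [h [g [gP ->]]]]; rewrite rmorph_sum.
apply: (big_ind (fun q => _ %| q)) => [|p q|i _]; [exact: dvdp0 | exact: dvdp_add |].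
rewrite rmorphM; apply: dvdp_mull; have [b [Ib ->]] := gP i.
rewrite rmorph_prod -{1}(card_ord m) -prodr_const.
apply: (big_ind2 (fun p q => p %| q)) => [|p q r s|j _]; [exact: dvdpp | exact: dvdp_mul |].
have [l [h' [g' [g'P ->]]]] := Ib j; rewrite rmorph_sum.
apply: (big_ind (fun q => _ %| q)) => [|p q|u _]; [exact: dvdp0 | exact: dvdp_add |].
rewrite rmorphM; apply/dvdp_mull; rewrite dvdp_XsubCl.
by have [[d hd] g'u] := g'P u; apply: restrict_line_root Pv Et hd g'u.
Qed.

End LineRestriction.

(** * Degree bounds forced by multiplicities *)

Section LowDegree.

Local Open Scope ring_scope.

Variables (K : closedFieldType) (n : nat).
Implicit Types (f g : {mpoly K[n.+1]}) (P : proj_point K n) (v : 'rV[K]_n.+1).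

Lemma coprimep_XnsubC (F : fieldType) (p : {poly F}) t m :
  ~~ root p t -> coprimep (('X - t%:P) ^+ m) p.
Proof. by move=> pt; rewrite coprimep_expl // coprimep_sym coprimep_XsubC. Qed.

(* Restrict to the generic line through v, parametrised over the field of
   fractions so as to take the value v at 0 and ('X_0, ..., 'X_n) at 1. *)
Lemma point_pow_low_degree P v f g m : val P = <[v]>%VS ->
    f.@[v 0] != 0 -> g \is m.-homog -> ideal_pow (point_ideal P) m.+1 (f * g) ->
  g = 0.
Proof.
move=> Pv fv hg Ifg.
pose F : fieldType := {fraction {mpoly K[n.+1]}}.
pose iota : {rmorphism K -> F} := (@tofrac _ \o @mpolyC n.+1 K : {rmorphism _ -> _}).
pose a (i : 'I_n.+1) : F := iota (v 0 i).
pose w (i : 'I_n.+1) : F := tofrac 'X_i - a i.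
have Ea i : a i + 0 * w i = 1 * iota (v 0 i) by rewrite mul0r addr0 mul1r.
have := restrict_line_dvdp Pv Ea Ifg; rewrite rmorphM /= Gauss_dvdpr; last first.
  apply: coprimep_XnsubC; rewrite /root restrict_line_horner.
  rewrite (_ : mmap _ _ _ = iota f.@[v 0]) ?fmorph_eq0 //.
  rewrite mevalE rmorph_sum; apply: eq_bigr => u _.
  rewrite rmorphM rmorph_prod; congr (_ * _); apply: eq_bigr => i _.
  by rewrite mul0r addr0 rmorphXn.
(* The restriction of [g] has degree at most [m] but is divisible by the power [m.+1], so it
   vanishes; its value at 1 is [g] itself. *)
move=> /dvdp_leq; have [r0 _|_ /(_ isT)] := eqVneq (restrict_line iota a w g) 0.
  apply/eqP; rewrite -(tofrac_eq0 g); apply/eqP.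
  rewrite -(horner0 1) -r0 restrict_line_horner [in LHS](mpolyE g) rmorph_sum.
  apply: eq_bigr => u _; rewrite -mul_mpolyC rmorphM; congr (_ * _).
  rewrite mpolyXE_id rmorph_prod; apply: eq_bigr => i _.
  by rewrite rmorphXn /= mul1r /w addrC subrK.
rewrite size_exp_XsubC => /leq_trans/(_ (size_restrict_line _ _ _ hg)).
by rewrite ltnn.
Qed.

(** On the line [v0] + t [w], the form [f] has order exactly [m] at 0, where it agrees with
    [g * h ^+ m] to order [m], and order at least m + 1 at [t1] and [t2]. Hence its degree is at
    least m + 2(m + 1). *)
Lemma collinear_degree_bound (P0 P1 P2 : proj_point K n) (v0 v1 v2 w : 'rV[K]_n.+1)
    t1 t2 c1 c2 f g h m d :
    val P0 = <[v0]>%VS -> val P1 = <[v1]>%VS -> val P2 = <[v2]>%VS ->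
    v0 + t1 *: w = c1 *: v1 -> v0 + t2 *: w = c2 *: v2 ->
    t1 != 0 -> t2 != 0 -> t1 != t2 ->
    g.@[v0 0] != 0 -> h \is 1.-homog -> h.@[v0 0] = 0 -> h.@[(c1 *: v1) 0] != 0 ->
    f \is d.-homog ->
    ideal_pow (point_ideal P0) m.+1 (f - g * h ^+ m) ->
    ideal_pow (point_ideal P1) m.+1 f -> ideal_pow (point_ideal P2) m.+1 f ->
  (3 * m + 2 <= d)%N.
Proof.
move=> Pv0 Pv1 Pv2 E1 E2 t1n0 t2n0 t12 gv0 hh hv0 hv1 hf I0 I1 I2.
pose r : {rmorphism {mpoly K[n.+1]} -> {poly K}} := restrict_line idfun (v0 0) (w 0).
have rE u t : (r u).[t] = u.@[(v0 + t *: w) 0].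
  by rewrite restrict_line_horner; apply: meval_eq => i; rewrite !mxE.
have Ev0 i : v0 0 i + 0 * w 0 i = 1 * v0 0 i by rewrite mul0r addr0 mul1r.
have Ev (v : 'rV_n.+1) t c : v0 + t *: w = c *: v ->
    forall i, v0 0 i + t * w 0 i = c * v 0 i.
  by move=> E i; have /rowP/(_ i) := E; rewrite !mxE.
have D0 : 'X^(m.+1) %| r f - r g * r h ^+ m.
  have := restrict_line_dvdp (iota := idfun) Pv0 Ev0 I0.
  by rewrite subr0 rmorphB rmorphM rmorphXn.
have D1 := restrict_line_dvdp (iota := idfun) Pv1 (Ev _ _ _ E1) I1.
have D2 := restrict_line_dvdp (iota := idfun) Pv2 (Ev _ _ _ E2) I2.
(* The restriction of [h] has degree at most 1, vanishes at 0 and is nonzero at [t1]. *)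
have [c cn0 rh] : exists2 c, c != 0 & r h = c *: 'X.
  have /factor_theorem[q Eq] : root (r h) 0 by rewrite /root rE scale0r addr0 hv0.
  have rh0 : r h != 0.
    by apply: contraNneq hv1 => rh0; rewrite -E1 -rE rh0 horner0.
  have q0 : q != 0 by apply: contraNneq rh0 => q0; rewrite Eq q0 mul0r.
  have : (size (r h) <= 2)%N by apply: size_restrict_line hh.
  rewrite Eq size_Mmonic ?monicXsubC // size_XsubC addn2 ltnS => sq.
  have Eq1 := size1_polyC sq; exists q`_0; first by rewrite -polyC_eq0 -Eq1.
  by rewrite {1}Eq1 subr0 mul_polyC.
have rgh : r g * r h ^+ m = (c ^+ m *: r g) * 'X^m.
  by rewrite rh exprZn -scalerAl -scalerAr.
have D0m : 'X^m %| r f.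
  rewrite -(subrK (r g * r h ^+ m) (r f)) dvdp_add //.
    by apply: dvdp_trans D0; rewrite exprS dvdp_mull.
  by rewrite rgh dvdp_mull.
(* Otherwise 'X^(m+1) would divide a nonzero multiple of [r g * 'X^m], and [g] would vanish at
   [v0]. *)
have rf0 : r f != 0.
  apply: contraTneq D0 => ->; rewrite sub0r dvdpNr rgh exprS dvdp_mul2r ?expf_neq0 ?polyX_eq0 //.
  by rewrite dvdpZr ?expf_neq0 // -['X]subr0 dvdp_XsubCl /root rE scale0r addr0.
have C12 : coprimep (('X - t1%:P) ^+ m.+1) (('X - t2%:P) ^+ m.+1).
  by apply: coprimep_XnsubC; rewrite root_exp_XsubC.
have C0 : coprimep ('X^m) (('X - t1%:P) ^+ m.+1 * ('X - t2%:P) ^+ m.+1).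
  have := @coprimep_XnsubC _ (('X - t1%:P) ^+ m.+1 * ('X - t2%:P) ^+ m.+1) 0 m.
  rewrite subr0; apply; rewrite rootM negb_or !root_exp_XsubC.
  by rewrite eq_sym t1n0 eq_sym.
have : 'X^m * (('X - t1%:P) ^+ m.+1 * ('X - t2%:P) ^+ m.+1) %| r f.
  by rewrite Gauss_dvdp // D0m Gauss_dvdp // D1.
move/dvdp_leq => /(_ rf0)/leq_trans/(_ (size_restrict_line _ _ _ hf)).
have E (t : K) : ('X - t%:P) ^+ m.+1 \is monic by rewrite monic_exp ?monicXsubC.
rewrite size_monicM ?monicXn ?monic_neq0 ?monicMl ?E // size_monicM ?monic_neq0 ?E //.
rewrite !size_exp_XsubC size_polyXn; clear; lia.
Qed.

End LowDegree.

Lemma dim_dhomog (R : nzRingType) n d : dim (dhomog n.+1 R d) = 'C(d + n, n).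
Proof. by rewrite -[in RHS](bin_sub (leq_addl d n)) addnK. Qed.

(** * Expected dimension and prescribed jets, for multiplicity m + 1 *)

Section FatPointSeparation.

Local Open Scope ring_scope.

Variables (K : closedFieldType) (n s m : nat).
Variables (P : 'I_s -> proj_point K n) (v : 'I_s -> 'rV[K]_n.+1).
Hypothesis Pv : forall i, val (P i) = <[v i]>%VS.

(** One form of degree [m] per point, standing for the jet of order [m] there. The dimension of [E]
    is the expected one for multiplicity [m.+1]. *)
Let E := {ffun 'I_s -> dhomog n.+1 K m}.

Lemma dim_ffun_dhomog : dim E = (s * 'C(m.+1 + n - 1, n))%N.
Proof.
rewrite /dim /= card_ord addSn subn1 /=; congr (_ * _)%N.
exact: dim_dhomog.
Qed.

Lemma ffun_dhomog_basis :
  exists X : (s * 'C(m.+1 + n - 1, n)).-tuple E, basis_of fullv X.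
Proof.
have := vbasisP (fullv : {vspace E}).
by move: (vbasis _); rewrite dimvf dim_ffun_dhomog => X; exists X.
Qed.

(** The map [phi] identifies [E] with the part of degree 2(m + 1) + m of the quotient: modulo the
    power [m.+1] at the i-th point only the term [Q i * g i] survives. *)
Lemma separating_quadrics_expected_dim (A B : 'I_s -> {mpoly K[n.+1]}) :
    (forall i, A i \is 1.-homog) -> (forall i, B i \is 1.-homog) ->
    (forall i, (A i * B i).@[v i 0] != 0) ->
    (forall i j, i != j -> (A i * B i).@[v j 0] = 0) ->
  has_expected_dim m.+1 P (3 * m + 2).
Proof.
move=> hA hB ABi ABj; have [X bX] := ffun_dhomog_basis.
pose Q i := (A i * B i) ^+ m.+1.
pose phi (g : E) := \sum_i Q i * (g i : {mpoly K[n.+1]}).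
have hQ i : Q i \is (2 * m.+1).-homog.
  by apply: dhomogMn; apply: (dhomogM (d := 1) (e := 1)).
have QI i j : i != j -> ideal_pow (point_ideal (P j)) m.+1 (Q i).
  move=> ij; apply: ideal_powX; have := ABj _ _ ij; rewrite mevalM => /eqP.
  rewrite mulf_eq0 => /orP[]/eqP z; last first.
    exact/ideal_genM/point_ideal_linear/z.
  by rewrite mulrC; apply/ideal_genM/point_ideal_linear/z.
have phiE (c : 'I__ -> K) : \sum_k c k *: phi X`_k = phi (\sum_k c k *: X`_k).
  rewrite /phi; under eq_bigr do rewrite scaler_sumr.
  rewrite exchange_big; apply: eq_bigr => i _ /=.
  rewrite sum_ffunE raddf_sum mulr_sumr; apply: eq_bigr => k _.
  by rewrite ffunE; apply: scalerAr.
have phiI i g : ideal_pow (point_ideal (P i)) m.+1 (phi g - Q i * g i).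
  rewrite /phi (bigD1 i) //= addrAC subrr add0r; apply: ideal_gen_sum => j ji.
  by rewrite mulrC; apply/ideal_genM/QI.
exists (fun k => phi X`_k); split=> [k|c|f hf].
- rewrite rpred_sum // => i _; rewrite (_ : (3 * m + 2)%N = (2 * m.+1 + m)%N).
    exact: dhomogM (hQ i) (dhomog_is_dhomog _).
  by clear; lia.
(* Independence: each [Q i * g i] lies in the power [m.+1] at its point while [Q i] is nonzero
   there, so the form [g i] of degree [m] is zero. *)
- rewrite phiE => I0; have /freeP := basis_free bX; apply.
  apply/ffunP => i; apply/val_inj; rewrite ffunE [RHS]raddf0.
  apply: (@point_pow_low_degree _ _ (P i) _ (Q i) _ m (Pv i)).
  + by rewrite /Q rmorphXn expf_neq0 //; apply: ABi.
  + exact: dhomog_is_dhomog.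
  + by have := ideal_genB (I0 i) (phiI i (\sum_k c k *: X`_k)); rewrite subKr.
have /fin_all_exists[g hg] : forall i, exists g : dhomog n.+1 K m,
    ideal_pow (point_ideal (P i)) m.+1 (f - Q i * g).
  move=> i; have := ABi i; rewrite mevalM mulf_eq0 negb_or => /andP[Ai Bi].
  (* The product of this list is [Q i], and dividing by it leaves degree [m]. *)
  pose hs := nseq m.+1 (A i) ++ nseq m.+1 (B i).
  have [||g hg] := @reduce_linear_prod _ _ _ _ (Pv i) hs m f.
  + by move=> h; rewrite mem_cat => /orP[]/nseqP[-> _].
  + by rewrite size_cat !size_nseq (_ : (m + _)%N = (3 * m + 2)%N) //; clear; lia.
  by rewrite big_cat !big_nseq !iter_mulr_1 /= -exprMn; exists (DHomog hg).
exists (fun k => coord X k (finfun g)) => i.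
rewrite phiE -(coord_basis bX (memvf _)) -(subrKA (Q i * finfun g i)).
apply: ideal_genD; first by rewrite ffunE; apply: hg.
by rewrite -opprB; apply/ideal_genN/phiI.
Qed.

(** Dividing by [h i ^+ d] turns each basis form [e k] into a jet family [X k] in [E]. A linear
    relation between the [X k] would put the same combination of the [e k] in the ideal, so they are
    independent; their number is the dimension of [E], so they span it. *)
Lemma expected_dim_jets (h : 'I_s -> {mpoly K[n.+1]}) d :
    (forall i, h i \is 1.-homog) -> (forall i, (h i).@[v i 0] != 0) ->
    has_expected_dim m.+1 P (m + d) ->
  forall G : 'I_s -> dhomog n.+1 K m, exists2 f, f \is (m + d).-homog &
    forall i, ideal_pow (point_ideal (P i)) m.+1 (f - h i ^+ d * G i).
Proof.
move=> hh hv [e [he freeE _]] G.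
have /fin_all_exists[X hX] : forall k, exists g : E, forall i,
    ideal_pow (point_ideal (P i)) m.+1 (e k - h i ^+ d * g i).
  move=> k; suff /fin_all_exists[g hg] : forall i, exists g : dhomog n.+1 K m,
      ideal_pow (point_ideal (P i)) m.+1 (e k - h i ^+ d * g).
    by exists (finfun g) => i; rewrite ffunE.
  move=> i; have [||g hg] := @reduce_linear_prod _ _ _ _ (Pv i) (nseq d (h i)) m (e k).
  + by move=> u /nseqP[-> _].
  + by rewrite size_nseq.
  by rewrite big_nseq iter_mulr_1; exists (DHomog hg).
have lin (c : 'I__ -> K) i : ideal_pow (point_ideal (P i)) m.+1
    (\sum_k c k *: e k - h i ^+ d * (\sum_k c k *: X k) i).
  rewrite sum_ffunE raddf_sum mulr_sumr -sumrB; apply: ideal_gen_sum => k _.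
  rewrite ffunE [X in _ - X](esym (scalerAr _ _ _)) -scalerBr -mul_mpolyC.
  by apply/ideal_genM/hX.
have freeX : free [tuple X k | k < _].
  apply/freeP => c; under eq_bigr do rewrite -tnth_nth tnth_mktuple.
  move=> c0; apply: freeE => i; have := lin c i.
  by rewrite c0 ffunE [X in _ * X]raddf0 mulr0 subr0.
have bX : basis_of fullv [tuple X k | k < _].
  by rewrite basisEfree freeX subvf dimvf dim_ffun_dhomog size_tuple /=.
pose c k := coord [tuple X k | k < _] k (finfun G).
exists (\sum_k c k *: e k).
  by rewrite rpred_sum // => k _; rewrite dhomogZ.
suff EG : \sum_k c k *: X k = finfun G by move=> i; have := lin c i; rewrite EG ffunE.
rewrite [RHS](coord_basis bX (memvf _)).
by apply: eq_bigr => k _; rewrite -tnth_nth tnth_mktuple.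
Qed.

(** Below degree [m] the whole space of forms has dimension at most C(m + n, n), less than [s] times
    this number. This provides the degree shape m + d that [expected_dim_jets] asks for. *)
Lemma expected_dim_degree_ge d : (1 < s)%N -> has_expected_dim m.+1 P d -> (m <= d)%N.
Proof.
move=> s1 [e [he freeE _]]; rewrite leqNgt; apply/negP => dm.
pose X := [tuple DHomog (he k) | k < s * 'C(m.+1 + n - 1, n)].
have freeX : free X.
  apply/freeP => c; under eq_bigr do rewrite -tnth_nth tnth_mktuple.
  move/(congr1 val); rewrite raddf_sum [RHS]raddf0 => c0.
  apply: freeE => i; under eq_bigr do rewrite -[e _]/(val (DHomog (he _))) -linearZ.
  by rewrite c0; apply: ideal_gen0.
have := dimvS (subvf <<X>>); rewrite (eqP freeX) size_tuple dimvf.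
apply/negP; rewrite -ltnNge dim_dhomog.
have : ('C(d + n, n) <= 'C(m + n, n))%N by apply: leq_bin2l; rewrite leq_add2r ltnW.
rewrite addSn subn1 /=; have : (0 < 'C(m + n, n))%N by rewrite bin_gt0 leq_addl.
by move: s1; clear; nia.
Qed.

End FatPointSeparation.

(** * The n + 4 points, their separating quadrics and the regularity index *)

Section Configuration.

Local Open Scope ring_scope.

Variables (K : closedFieldType) (n : nat).
Hypothesis n_ge2 : (2 <= n)%N.

(* The k-th point is e_k for k <= n; for k = n + 1 + i it is the sum of the two
   basis vectors e_j with j <= 2 and j != i. *)
Definition point_supp (k j : nat) : bool :=
  if (k <= n)%N then j == k else (j <= 2)%N && (j + n.+1 != k)%N.

Definition point_vec (k : nat) : 'rV[K]_n.+1 := \row_j (point_supp k j)%:R.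

(** For [i] at most 2, [fst_other i] and [snd_other i] are the other two indices among 0, 1, 2, in
    increasing order. *)
Let fst_other (i : nat) : nat := (i == 0)%N.
Let snd_other (i : nat) : nat := if (i == 2)%N then 1%N else 2%N.

Let fst_var k := if (k <= n)%N then k else fst_other (k - n.+1).
Let snd_var k := if (k <= n)%N then k else snd_other (k - n.+1).

Let X (j : nat) : {mpoly K[n.+1]} := 'X_(inord j).

(** With a, b the other two indices, the quadric [sep_fst k * sep_snd k] is X_k (X_k - X_a - X_b)
    for k <= 2 and X_k^2 for 2 < k <= n. For k = n + 1 + i it is X_a X_b, with a, b the indices
    other than i. *)
Definition sep_fst (k : nat) : {mpoly K[n.+1]} := X (fst_var k).
Definition sep_snd (k : nat) : {mpoly K[n.+1]} :=
  if (k <= 2)%N then X k - X (fst_other k) - X (snd_other k) else X (snd_var k).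

Let X_vec j k : (j <= n)%N -> (X j).@[point_vec k 0] = (point_supp k j)%:R.
Proof. by move=> jn; rewrite mevalXU mxE inordK. Qed.

Lemma sep_fst_homog k : sep_fst k \is 1.-homog.
Proof. exact: dhomogXU. Qed.

Lemma sep_snd_homog k : sep_snd k \is 1.-homog.
Proof.
by rewrite /sep_snd; case: ifP => _; rewrite ?rpredB //; apply: dhomogXU.
Qed.

Let fst_var_le k : (k < n + 4)%N -> (fst_var k <= n)%N.
Proof. rewrite /fst_var /fst_other; case: ifP => //; lia. Qed.

Let snd_var_le k : (k < n + 4)%N -> (snd_var k <= n)%N.
Proof. rewrite /snd_var /snd_other; do !case: ifP => //; lia. Qed.

Let sep_sndE k l : (k <= 2)%N -> (sep_snd k).@[point_vec l 0] =
  (point_supp l k)%:R - (point_supp l (fst_other k) + point_supp l (snd_other k))%:R.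
Proof.
move=> k2; rewrite /sep_snd k2 !mevalB !X_vec ?natrD ?opprD ?addrA //.
- by rewrite /snd_other; case: ifP; lia.
- by rewrite /fst_other; lia.
- lia.
Qed.

Lemma sep_neq0 k : (k < n + 4)%N -> (sep_fst k * sep_snd k).@[point_vec k 0] != 0.
Proof.
move=> kn; rewrite mevalM X_vec ?fst_var_le //.
have -> : point_supp k (fst_var k).
  by rewrite /point_supp /fst_var /fst_other; do ?case: ifP; lia.
rewrite mul1r; have [k2|k2] := leqP k 2.
  rewrite sep_sndE // (_ : point_supp k k); last first.
    by rewrite /point_supp (leq_trans k2).
  rewrite (_ : _ + _ = 0)%N ?subr0 ?oner_neq0 //.
  rewrite /point_supp (leq_trans k2) // /fst_other /snd_other.
  by move: k2; case: (k) => [|[|[|]]].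
rewrite /sep_snd leqNgt k2 /= X_vec ?snd_var_le // (_ : point_supp _ _) ?oner_neq0 //.
by rewrite /point_supp /snd_var /snd_other; do ?case: ifP; lia.
Qed.

Lemma sep_eq0 k l : (k < n + 4)%N -> (l < n + 4)%N -> k != l ->
  (sep_fst k * sep_snd k).@[point_vec l 0] = 0.
Proof.
move=> kn ln kl; rewrite mevalM X_vec ?fst_var_le //.
case Dl: (point_supp l (fst_var k)); last by rewrite mul0r.
rewrite mul1r; have [k2|k2] := leqP k 2.
  rewrite sep_sndE // (_ : point_supp l k); last first.
    by move: Dl; rewrite /fst_var (leq_trans k2).
  (* A point other than e_k with nonzero k-th coordinate is e_k plus exactly one of the other two
     basis vectors. *)
  rewrite (_ : _ + _ = 1)%N ?subrr //; move: Dl.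
  rewrite /point_supp /fst_var /fst_other /snd_other.
  by move: k2 kl; case: (k) => [|[|[|]]] //= _; do ?case: ifP => //=; lia.
rewrite /sep_snd leqNgt k2 /= X_vec ?snd_var_le // (_ : point_supp _ _ = false) //.
move: Dl; rewrite /point_supp /fst_var /fst_other /snd_var /snd_other.
by do ?case: ifP; lia.
Qed.

Lemma dim_point_line (k : 'I_(n + 4)) : \dim <[point_vec k]> == 1%N.
Proof.
rewrite dim_vline eqb1; apply: contraTneq (sep_neq0 (ltn_ord k)) => ->.
by rewrite mevalM mevalXU mxE mul0r eqxx.
Qed.

Definition conf_point (k : 'I_(n + 4)) : proj_point K n :=
  exist _ <[point_vec k]>%VS (dim_point_line k).

(** The quadric of [k] is nonzero at the k-th point and zero at all others, so it tells the points
    apart. *)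
Lemma conf_point_inj : injective conf_point.
Proof.
move=> k l /(congr1 val) /= kl; apply/val_inj/eqP; apply: contraTT isT => nkl.
have := sep_eq0 (ltn_ord k) (ltn_ord l) nkl; have := sep_neq0 (ltn_ord k).
rewrite !mevalM mulf_eq0 negb_or => /andP[fk gk] /eqP; rewrite mulf_eq0.
have van f : f \is 1.-homog -> f.@[point_vec l 0] = 0 -> f.@[point_vec k 0] = 0.
  move=> hf fl; apply: (dhomog1_vanishes (P := conf_point l) erefl hf fl).
  by rewrite /= -kl memv_line.
by case/orP=> /eqP/van E; rewrite E ?eqxx // ?sep_fst_homog ?sep_snd_homog in fk gk.
Qed.

Lemma conf_point_non_degenerate : non_degenerate conf_point.
Proof.
apply/eqP; rewrite eqEsubv subvf; apply/subvP => u _.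
rewrite (row_sum_delta u) memv_suml // => j _; apply: memvZ.
have jn : (j < n + 4)%N by apply: leq_trans (ltn_ord j) _; rewrite addnS ltnS leq_addr.
have -> : delta_mx 0 j = point_vec (Ordinal jn).
  by apply/rowP => i; rewrite !mxE /point_supp /= -ltnS ltn_ord.
by apply: (subvP (sumv_sup (Ordinal jn) _ (subvv _))); rewrite ?memv_line.
Qed.

Lemma conf_point_reg m : is_regularity_index m.+1 conf_point (3 * m + 2).
Proof.
have Pv k : val (conf_point k) = <[point_vec k]>%VS by [].
split=> [|t et].
  apply: (@separating_quadrics_expected_dim _ _ _ _ _ _ Pv sep_fst sep_snd) => [k|k|k|k l].
  - exact: sep_fst_homog.
  - exact: sep_snd_homog.
  - exact: sep_neq0 (ltn_ord k).
  - exact: sep_eq0 (ltn_ord k) (ltn_ord l).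
have [d Et] : exists d, t = (m + d)%N.
  exists (t - m)%N; rewrite subnKC // (expected_dim_degree_ge _ et) //.
  by rewrite addnS ltnS addn_gt0 orbT.
rewrite {t}Et in et *.
have i0n : (0 < n + 4)%N by rewrite addnS.
have i1n : (1 < n + 4)%N by rewrite !addnS.
(* Index n + 3 = (n + 1) + 2 is the point e_0 + e_1. *)
have i2n : (n + 3 < n + 4)%N by rewrite ltn_add2l.
have hX : X 1 ^+ m \is m.-homog.
  by have := dhomogMn m (dhomogXU _ (inord 1)); rewrite mul1n; apply.
have fstP (k : 'I_(n + 4)) : (sep_fst k).@[point_vec k 0] != 0.
  by have := sep_neq0 (ltn_ord k); rewrite mevalM mulf_eq0 negb_or => /andP[].
(* The prescribed jet is X_1^m at e_0, where X_1 vanishes, and zero at every other point. *)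
have [f hf fP] := @expected_dim_jets _ _ _ _ _ _ Pv sep_fst _
  (fun k => sep_fst_homog k) fstP et
  (fun k => if k == Ordinal i0n then DHomog hX else 0).
(* With w = b e_1 - e_0, all three points of the line are finite in the
   parametrisation e_0 + t w as soon as b and 1 + b are nonzero; over F_2 no such
   b exists, hence the detour through a root of b^2 + b + 1. *)
have [b] := @GRing.solve_monicpoly K 2 (fun=> -1) isT.
rewrite big_ord_recl big_ord1 expr0 expr1 mulr1 mulN1r => Eb.
have b0 : b != 0.
  by apply/eqP => b0; move/eqP: Eb; rewrite b0 expr0n subr0 eq_sym oppr_eq0 oner_eq0.
have b1 : 1 + b != 0.
  apply/eqP => /eqP; rewrite addr_eq0 => /eqP b1; move/eqP: Eb.
  by rewrite -b1 addNr expf_eq0 (negPf b0).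
pose w := b *: point_vec 1 - point_vec 0.
(* The line passes through b e_1 at parameter 1 and through b/(1 + b) (e_0 + e_1) at parameter 1/(1
   + b). *)
apply: (@collinear_degree_bound _ _ (conf_point (Ordinal i0n))
  (conf_point (Ordinal i1n)) (conf_point (Ordinal i2n)) _ _ _ w 1 (1 + b)^-1
  b (b / (1 + b)) f (sep_fst 0 ^+ d) (X 1) m _ erefl erefl erefl) => //.
- by rewrite scale1r addrC subrK.
- apply/rowP => i; rewrite !mxE /point_supp /= (ltnW n_ge2).
  have -> : (n + 3 <= n)%N = false by clear; lia.
  have -> : (i + n.+1 != n + 3)%N = (i != 2 :> nat) by clear; lia.
  have [-> | i0] := eqVneq (i : nat) 0%N; first by rewrite /=; field.
  have [-> | i1] := eqVneq (i : nat) 1%N; first by rewrite /=; field.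
  rewrite (_ : (_ && _) = false); last by move: i0 i1; clear; lia.
  by rewrite !mulr0 subr0 mulr0 addr0.
- exact: oner_neq0.
- by rewrite invr_eq0.
- apply: contra_neq b0 => /(congr1 (fun x => x * (1 + b))).
  by rewrite mul1r mulVf // => /(canRL (addKr _)) ->; rewrite addNr.
- by rewrite rmorphXn expf_neq0 //; apply: (fstP (Ordinal i0n)).
- exact: dhomogXU.
- by rewrite X_vec ?(leq_trans _ n_ge2).
- by rewrite mevalXU !mxE inordK ?leqW // /point_supp /= (ltnW n_ge2) mulr1.
- by have := fP (Ordinal i1n); rewrite [X in _ * X]raddf0 mulr0 subr0.
- have := fP (Ordinal i2n); rewrite -val_eqE /= addn_eq0 andbF.
  by rewrite [X in _ * X]raddf0 mulr0 subr0.
Qed.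

(** * Points on linear subspaces and the value of T(Z) *)

Lemma span_coord0 (s : seq nat) (k : 'I_n.+1) u :
    all (fun i => i <= n)%N s -> (k : nat) \notin s ->
  u \in <<map point_vec s>>%VS -> u 0 k = 0.
Proof.
elim: s u => [|i s IHs] u /=.
  by move=> _ _; rewrite span_nil memv0 => /eqP->; rewrite mxE.
case/andP=> le_in les; rewrite inE negb_or => /andP[nki nks].
rewrite span_cons => /memv_addP[_ /vlineP[c ->] [v vs ->]].
by rewrite !mxE (IHs v) // /point_supp le_in (negPf nki) mulr0 addr0.
Qed.

Lemma free_basis_vectors (s : seq nat) :
  all (fun i => i <= n)%N s -> uniq s -> free (map point_vec s).
Proof.
elim: s => [|k s IHs] /=; first by rewrite nil_free.
case/andP=> le_kn les /andP[nks us]; rewrite free_cons IHs // andbT.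
apply/negP => /(span_coord0 (k := Ordinal (le_kn : k < n.+1)%N) les nks) /eqP.
by rewrite mxE /point_supp le_kn eqxx oner_eq0.
Qed.

Let plane := <<map point_vec [:: 0; 1; 2]%N>>%VS.

Let six := [:: 0; 1; 2; n.+1; n.+2; n.+3]%N.

Let le_012 : all (fun i => i <= n)%N [:: 0; 1; 2]%N.
Proof. by rewrite /= n_ge2 (ltnW n_ge2). Qed.

Let dim_plane : \dim plane = 3%N.
Proof. exact/eqP/free_basis_vectors. Qed.

Let vec_sum0 : point_vec 1 + point_vec 2 = point_vec n.+1.
Proof.
apply/rowP => i; rewrite !mxE /point_supp n_ge2 (ltnW n_ge2) ltnn -natrD.
case: (nat_of_ord i) => [|[|[|k]]] /=; congr _%:R; clear; lia.
Qed.

Let vec_sum1 : point_vec 0 + point_vec 2 = point_vec n.+2.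
Proof.
apply/rowP => i; rewrite !mxE /point_supp n_ge2 leq0n.
rewrite (_ : (n.+2 <= n)%N = false) -?natrD; last by clear; lia.
by case: (nat_of_ord i) => [|[|[|k]]] /=; congr _%:R; clear; lia.
Qed.

Let vec_sum2 : point_vec 0 + point_vec 1 = point_vec n.+3.
Proof.
apply/rowP => i; rewrite !mxE /point_supp (ltnW n_ge2) leq0n.
rewrite (_ : (n.+3 <= n)%N = false) -?natrD; last by clear; lia.
by case: (nat_of_ord i) => [|[|[|k]]] /=; congr _%:R; clear; lia.
Qed.

Let six_plane k : k \in six -> point_vec k \in plane.
Proof.
have b j : j \in [:: 0; 1; 2]%N -> point_vec j \in plane.
  by move=> j3; apply/memv_span/map_f.
by rewrite !inE => /or4P[|||/or3P[]] /eqP->; rewrite -?vec_sum0 -?vec_sum1 -?vec_sum2;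
  rewrite ?memvD ?b.
Qed.

(* Each side of the triangle e_0 e_1 e_2 carries three of the six points, any two
   of which span it. *)
Let six_count (U : {vspace 'rV[K]_n.+1}) :
  (\dim U <= 2)%N -> (count (fun k => point_vec k \in U) six <= 3)%N.
Proof.
move=> dU; have : ~~ [&& point_vec 0 \in U, point_vec 1 \in U & point_vec 2 \in U].
  apply/negP => /and3P[u0 u1 u2]; have : (plane <= U)%VS.
    by apply/span_subvP => u /mapP[k]; rewrite !inE => /or3P[]/eqP-> ->.
  by move/dimvS; rewrite dim_plane leqNgt ltnS dU.
have third x y z : x + y = z ->
    [&& (x \in U) && (y \in U) ==> (z \in U), (x \in U) && (z \in U) ==> (y \in U)
      & (y \in U) && (z \in U) ==> (x \in U)].
  move=> <-; apply/and3P; split; apply/implyP => /andP[].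
  - exact: memvD.
  - by move=> xU; rewrite rpredDl.
  - by move=> yU; rewrite rpredDr.
move: (third _ _ _ vec_sum0) (third _ _ _ vec_sum1) (third _ _ _ vec_sum2).
rewrite /six /=.
(* What remains is propositional: a set of the six points closed under the three side relations and
   missing a vertex has at most three members. *)
by do 6!case: (point_vec _ \in U).
Qed.

(** The bound is 0, 1, 3 for \dim U = 0, 1, 2; the default value 6 of [nth] covers all larger
    dimensions. *)
Let card_six_le (U : {vspace 'rV[K]_n.+1}) (B : {set 'I_(n + 4)}) :
    (forall i, i \in B -> (i : nat) \in six /\ (val (conf_point i) <= U)%VS) ->
  (#|B| <= if \dim U is d.+1 then nth 6 [:: 1; 3] d else 0)%N.
Proof.
move=> BU; have cU : (#|B| <= count (fun k => point_vec k \in U) six)%N.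
  rewrite -size_filter cardE -(size_map val); apply: uniq_leq_size.
    by rewrite map_inj_uniq ?enum_uniq //; apply: val_inj.
  move=> _ /mapP[i + ->]; rewrite mem_enum mem_filter => /BU[-> /subvP->] //.
  exact: memv_line.
have [d0|] := posnP (\dim U).
  rewrite d0 leqn0 cards_eq0; apply/eqP/setP => i; rewrite inE; apply/negP => /BU[_].
  by move/dimvS; rewrite d0 (eqP (valP (conf_point i))).
case Ed: (\dim U) => [//|[|d]] _.
  have BE i : i \in B -> val (conf_point i) = U.
    by case/BU=> _ iU; apply/eqP; rewrite eqEdim iU Ed (eqP (valP (conf_point i))).
  apply/card_le1_eqP => i k /BE iU /BE kU.
  by apply/conf_point_inj/val_inj; rewrite iU kU.
case: d Ed => [|d] Ed; apply: leq_trans cU _.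
  by apply: six_count; rewrite Ed.
by apply: leq_trans (count_size _ _) _; rewrite /= nth_nil.
Qed.

(** The points of [B] off the plane are basis vectors independent of it, so at most j + 1 - \dim U
    of them lie in [W], where [U] is the trace of [W] on the plane. Adding the bound for the six
    points gives at most 3j for each value of \dim U. *)
Lemma card_points_on_subspace j (W : {vspace 'rV[K]_n.+1}) (B : {set 'I_(n + 4)}) :
    (0 < j)%N -> \dim W = j.+1 ->
    (forall i, i \in B -> (val (conf_point i) <= W)%VS) ->
  (#|B| <= 3 * j)%N.
Proof.
move=> j0 dW BW; pose S := [set i : 'I_(n + 4) | (i : nat) \in six].
pose s := [seq nat_of_ord i | i <- enum (B :\: S)].
have sP i : i \in s -> [/\ 2 < i, i <= n & point_vec i \in W]%N.
  case/mapP=> k; rewrite mem_enum !inE => /andP[k6 /BW/subvP kW] ->.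
  rewrite kW ?memv_line; split=> //; move: k6 (ltn_ord k); clear; lia.
have : free (map point_vec s ++ map point_vec [:: 0; 1; 2]%N).
  rewrite -map_cat; apply: free_basis_vectors.
    by rewrite all_cat le_012 andbT; apply/allP => i /sP[].
  rewrite cat_uniq map_inj_uniq ?enum_uniq //=; last exact: ord_inj.
  by rewrite orbF andbT !negb_or; apply/and3P; split; apply/negP => /sP[].
rewrite cat_free => /and3P[fs _ /directv_addP dsp].
pose U := (W :&: plane)%VS.
have dsU : (size s + \dim U <= j.+1)%N.
  rewrite -dW -(size_map point_vec) -(eqP fs) -dimv_disjoint_sum.
    apply: dimvS; rewrite subv_add capvSl andbT.
    by apply/span_subvP => _ /mapP[i /sP[_ _ iW] ->].
  by apply/eqP; rewrite -subv0 -dsp capvS ?capvSr.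
have BU : (#|B :&: S| <= if \dim U is d.+1 then nth 6 [:: 1; 3] d else 0)%N.
  apply: card_six_le => i /setIP[/BW iW]; rewrite in_set => i6; split=> //.
  by rewrite subv_cap iW /= -memvE; apply: six_plane.
have dU : (\dim U <= 3)%N by rewrite -dim_plane dimvS ?capvSr.
rewrite -(cardsID S B); move: dsU BU; rewrite size_map -cardE.
move: dU j0 (#|B :&: S|) (#|B :\: S|); case: (\dim U) => [|[|[|[|]]]] //= _; clear; lia.
Qed.

Lemma conf_point_Tmax m : (0 < m)%N -> Tmax m conf_point = (3 * m)%N.
Proof.
move=> m0; apply/eqP; rewrite eqn_leq; apply/andP; split.
  rewrite /Tmax big_nat; apply/bigmax_leqP_seq => j _ /andP[j0 jn].
  apply/bigmax_leqP => B /asboolP[W [dW BW]].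
  (* With at most 3j points the numerator stays below (3m + 1) j, so the integer part is at most
     3m. *)
  have cB := card_points_on_subspace j0 dW BW; rewrite -ltnS ltn_divLR //.
  by move: (#|B|) j0 m0 cB; clear; nia.
(* The value is attained at j = 2 by the six coplanar points, which give 6m/2. *)
apply: (@leq_trans (Tj m conf_point 2)); last first.
  by rewrite /Tmax (@leq_bigmax_seq _ _ _ (Tj m conf_point)) // mem_index_iota.
pose S := [set i : 'I_(n + 4) | (i : nat) \in six].
have S6 : (6 <= #|S|)%N.
  rewrite cardE -(size_map val) -[6%N]/(size six); apply: uniq_leq_size.
    by rewrite /= !inE; move: n_ge2; clear; lia.
  move=> k k6; have kn : (k < n + 4)%N.
    by move: k6; rewrite !inE; move: n_ge2; clear; lia.
  by apply/mapP; exists (Ordinal kn) => //; rewrite mem_enum inE.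
apply: (@leq_trans ((m * #|S| + 2 - 2) %/ 2)).
  by rewrite addnK leq_divRL //; move: (#|S|) S6; clear; nia.
apply: (@leq_bigmax_cond _ _ (fun B : {set _} => (m * #|B| + 2 - 2) %/ 2)%N).
apply/asboolP; exists plane; split=> [//|i]; rewrite inE => i6.
by apply/subvP => _ /vlineP[c ->]; apply/memvZ/six_plane.
Qed.

End Configuration.

Theorem corollary4p5 (K : closedFieldType) (m n : nat)
    (hm : (0 < m)%N) (hn : (2 <= n)%N) :
  exists P : 'I_(n + 4) -> proj_point K n,
    [/\ injective P,
        non_degenerate P,
        is_regularity_index m P (3 * m - 1),
        (3 * m - 1 < Tmax m P)%N
      & Tmax m P = (3 * m)%N].
Proof.
exists (@conf_point K n hn); rewrite conf_point_Tmax //; split=> //.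
- exact: conf_point_inj.
- exact: conf_point_non_degenerate.
- case: m hm => // m _; rewrite (_ : (3 * m.+1 - 1)%N = (3 * m + 2)%N); last lia.
  exact: conf_point_reg.
- lia.
Qed.
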